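(* The reduction $\triangleright$ is confluent on fair terms: for every fair term $t$, if $t\triangleright^* t_1$ and $t\triangleright^* t_2$, then there is a term $t_3$ with $t_1\triangleright^* t_3$ and $t_2\triangleright^* t_3$.
   Context: Atoms are the variables (from an infinite set) and the constants $S_0,S_1,S_2,S_3,K_0,K_1,I_0,I_1$. Terms: $T::= \alpha \mid (T\ T)$ for atoms $\alpha$; application associates to the left. For $i\in\{0,1\}$, a variable $x$ and a term $t$, the set of terms $\lambda_i x.t$ is defined by: if $t=x$, $\lambda_i x.t=\{I_i\}$; if $t\neq x$ is an atom, $\lambda_i x.t=\{(K_i\ t)\}$; if $t=(u\ v)$ and $x$ does not occur in $t$, $\lambda_i x.t=\{(K_i\ t)\}\cup\{(S_{i+2}\ u'\ v') : u'\in\lambda_i x.u,\ v'\in\lambda_i x.v\}$; if $t=(u\ v)$ and $x$ occurs in $t$, $\lambda_i x.t=\{(S_{i+2}\ u'\ v') : u'\in\lambda_i x.u,\ v'\in\lambda_i x.v\}$. The reduction $\triangleright$ on terms is the closure under application contexts of: $(S_i\ u\ v\ w)\triangleright(u\ w\ (v\ w))$ for $i=1,3$; $(K_1\ u\ v)\triangleright u$; $(I_1\ u)\triangleright u$; $(S_{i+2}\ (K_i\ u)\ (K_i\ v))\triangleright(K_i\ (u\ v))$ for $i=0,1$; and, for $i=0,1$: if $u\triangleright v$, $t\in\lambda_i x.u$ and $t'\in\lambda_i x.v$ then $t\triangleright t'$. $\triangleright^*$ is its reflexive–transitive closure. An address is a finite list over $\{l,r\}$; $u_a$ is the subterm of $u$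 at address $a$ ($u_\varepsilon=u$, $(u\ v)_{l::a}=u_a$, $(u\ v)_{r::a}=v_a$), and $a<a'$ means $a$ is an initial segment of $a'$. A pair $(u,f)$, with $f$ a function from a set of addresses of $u$ into terms, is adequate if there are no $a,a'\in\mathrm{dom}(f)$ with $a<a'$. For adequate $(u,f)$ and a variable $x$, $\phi_x(u,f)$ denotes any term obtained from $u$ by replacing, for each $a\in\mathrm{dom}(f)$, the subterm at address $a$ by $(w_a\ f(a))$ for some $w_a\in\lambda_1 x.u_a$. The set $F$ of fair terms is the smallest set such that: every variable, $S_0$, $K_0$, $I_0$ are fair; if $u,v$ are fair so is $(u\ v)$; if $u$ is fair and $t\in\lambda_0 x.u$ then $t$ is fair; if $v_1,v_2,v_3$ are fair then so are $(S_1\ v_1\ v_2\ v_3)$, $(K_1\ v_1\ v_2)$, $(I_1\ v_1)$; if $x$ is a variable, $u$ is fair, every term in the image of $f$ is fair and $(u,f)$ is adequate, then $\phi_x(u,f)$ is fair. *)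

(* Defs.v *)
From Stdlib Require Import List Relations FinFun.
Import ListNotations.

Set Implicit Arguments.

Inductive idx : Set := i0 | i1.

Inductive term (V : Type) : Type :=
| Var (x : V)
| S0 | S1 | S2 | S3 | K0 | K1 | I0 | I1
| App (u v : term V).

Arguments S0 {V}. Arguments S1 {V}. Arguments S2 {V}. Arguments S3 {V}.
Arguments K0 {V}. Arguments K1 {V}. Arguments I0 {V}. Arguments I1 {V}.

Declare Scope term_scope.
Delimit Scope term_scope with term.
Bind Scope term_scope with term.
Notation "u @ v" := (App u v) (at level 40, left associativity) : term_scope.
Local Open Scope term_scope.

Definition K {V : Type} (i : idx) : term V :=
  match i with i0 => K0 | i1 => K1 end.

Definition I {V : Type} (i : idx) : term V :=
  match i with i0 => I0 | i1 => I1 end.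

(* [Sup i] is the constant S_{i+2}. *)
Definition Sup {V : Type} (i : idx) : term V :=
  match i with i0 => S2 | i1 => S3 end.

Definition is_atom {V : Type} (t : term V) : Prop :=
  match t with App _ _ => False | _ => True end.

Fixpoint occurs {V : Type} (x : V) (t : term V) : Prop :=
  match t with
  | Var y => y = x
  | u @ v => occurs x u \/ occurs x v
  | _ => False
  end.

(* [lam i x t t'] means t' ∈ λ_i x.t. *)
Inductive lam {V : Type} (i : idx) (x : V) : term V -> term V -> Prop :=
| lam_var : lam i x (Var x) (I i)
| lam_atom (t : term V) :
    is_atom t -> t <> Var x -> lam i x t (K i @ t)
| lam_K (u v : term V) :
    ~ occurs x (u @ v) -> lam i x (u @ v) (K i @ (u @ v))
| lam_S (u v u' v' : term V) :
    lam i x u u' -> lam i x v v' -> lam i x (u @ v) (Sup i @ u' @ v').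

Inductive red {V : Type} : term V -> term V -> Prop :=
| red_S1 (u v w : term V) : red (S1 @ u @ v @ w) (u @ w @ (v @ w))
| red_S3 (u v w : term V) : red (S3 @ u @ v @ w) (u @ w @ (v @ w))
| red_K1 (u v : term V) : red (K1 @ u @ v) u
| red_I1 (u : term V) : red (I1 @ u) u
| red_SK (i : idx) (u v : term V) :
    red (Sup i @ (K i @ u) @ (K i @ v)) (K i @ (u @ v))
| red_lam (i : idx) (x : V) (u v t t' : term V) :
    red u v -> lam i x u t -> lam i x v t' -> red t t'
| red_appl (u u' v : term V) : red u u' -> red (u @ v) (u' @ v)
| red_appr (u v v' : term V) : red v v' -> red (u @ v) (u @ v').

Inductive dir : Set := L | R.

Definition address : Set := list dir.

(* [None] when the address does not exist in the term. *)
Fixpoint subterm {V : Type} (u : term V) (a : address) : option (term V) :=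
  match a, u with
  | [], _ => Some u
  | L :: a', u1 @ _ => subterm u1 a'
  | R :: a', _ @ u2 => subterm u2 a'
  | _ :: _, _ => None
  end.

Definition strict_prefix (a a' : address) : Prop :=
  exists b : address, b <> [] /\ a' = a ++ b.

(* The domain of the partial function [f] is the set where it is not [None]. *)
Definition in_dom {V : Type} (f : address -> option (term V)) (a : address) :
    Prop :=
  f a <> None.

Definition adequate {V : Type} (u : term V) (f : address -> option (term V)) :
    Prop :=
  (forall a, in_dom f a -> subterm u a <> None) /\
  ~ (exists a a', in_dom f a /\ in_dom f a' /\ strict_prefix a a').

(* Simultaneous replacement in [u] of the subterm at each address [a] with
   [g a = Some s] by [s]; intended for [g] whose domain is an antichain, so
   that no replacement hides another. *)
Fixpoint replace {V : Type} (u : term V) (g : address -> option (term V)) :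
    term V :=
  match g [] with
  | Some s => s
  | None =>
      match u with
      | u1 @ u2 =>
          replace u1 (fun a => g (L :: a)) @ replace u2 (fun a => g (R :: a))
      | _ => u
      end
  end.

(* [phi x u f t] means that t is one of the terms denoted by φ_x(u, f). *)
Definition phi {V : Type} (x : V) (u : term V)
    (f : address -> option (term V)) (t : term V) : Prop :=
  exists w : address -> term V,
    (forall a ua, in_dom f a -> subterm u a = Some ua -> lam i1 x ua (w a)) /\
    t = replace u (fun a => option_map (App (w a)) (f a)).

Inductive fair {V : Type} : term V -> Prop :=
| fair_var (x : V) : fair (Var x)
| fair_S0 : fair S0
| fair_K0 : fair K0
| fair_I0 : fair I0
| fair_app (u v : term V) : fair u -> fair v -> fair (u @ v)
| fair_lam (x : V) (u t : term V) : fair u -> lam i0 x u t -> fair t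
| fair_S1 (v1 v2 v3 : term V) :
    fair v1 -> fair v2 -> fair v3 -> fair (S1 @ v1 @ v2 @ v3)
| fair_K1 (v1 v2 : term V) : fair v1 -> fair v2 -> fair (K1 @ v1 @ v2)
| fair_I1 (v1 : term V) : fair v1 -> fair (I1 @ v1)
| fair_phi (x : V) (u : term V) (f : address -> option (term V)) (t : term V) :
    fair u -> (forall a s, f a = Some s -> fair s) -> adequate u f ->
    phi x u f t -> fair t.

(* Main.v *)
(** Enlarge the terms with binders [λ_0] and [λ_1], and let the constants unfold
    towards them: [I_i → λ_i x.x], [K_i M → λ_i x.M],
    [S_{i+2} (λ_i x.M) (λ_i x.N) → λ_i x.(M N)],
    together with beta for [λ_1] only and the usual rules of [S_1] and [S_3].
    The one critical pair, between the two rules of [S_3], is joinable, and the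
    calculus has the Z property for full superdevelopments, hence is
    Church-Rosser.  Every member of [λ_i x.u] unfolds to the binder
    [λ_i x.u], so ▷ is contained in conversion; conversely, bracket abstraction
    with as many [K_i] as possible commutes with substitution and turns each
    step into ▷-steps.  A common reduct of [t1] and [t2] in the enlarged
    calculus is therefore sent to a common ▷-reduct. *)

Require Import Defs.
From Stdlib Require Import Relations FinFun List Classical ClassicalEpsilon.

Set Implicit Arguments.
Local Open Scope term_scope.

(** * A lambda calculus with constants *)

Inductive const : Set := cS0 | cS1 | cSup (i : idx) | cK (i : idx) | cI (i : idx).

(* The bound variable of [LLam i M] is the [None] of [M : lterm (option V)]. *)
Inductive lterm (V : Type) : Type :=
| LVar (x : V)
| LCst (c : const)
| LApp (M N : lterm V)
| LLam (i : idx) (M : lterm (option V)).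

Arguments LCst {V}.

Fixpoint lren {V W : Type} (r : V -> W) (M : lterm V) : lterm W :=
  match M with
  | LVar x => LVar (r x)
  | LCst c => LCst c
  | LApp A B => LApp (lren r A) (lren r B)
  | LLam i A => LLam i (lren (option_map r) A)
  end.

Definition lup {V W : Type} (s : V -> lterm W) (o : option V) :
    lterm (option W) :=
  match o with None => LVar None | Some x => lren Some (s x) end.

Fixpoint lsubst {V W : Type} (s : V -> lterm W) (M : lterm V) : lterm W :=
  match M with
  | LVar x => s x
  | LCst c => LCst c
  | LApp A B => LApp (lsubst s A) (lsubst s B)
  | LLam i A => LLam i (lsubst (lup s) A)
  end.

Definition inst {V : Type} (N : lterm V) (o : option V) : lterm V :=
  match o with None => N | Some x => LVar x end.

Lemma lsubst_ext V (M : lterm V) : forall W (s s' : V -> lterm W),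
  (forall x, s x = s' x) -> lsubst s M = lsubst s' M.
Proof.
  induction M as [V x|V c|V A IA B IB|V i A IA]; intros W s s' E; simpl; auto.
  - rewrite (IA _ _ _ E), (IB _ _ _ E); reflexivity.
  - f_equal. apply IA. intros [x|]; simpl; [rewrite E|]; reflexivity.
Qed.

Lemma lren_as_lsubst V (M : lterm V) : forall W (r : V -> W),
  lren r M = lsubst (fun x => LVar (r x)) M.
Proof.
  induction M as [V x|V c|V A IA B IB|V i A IA]; intros W r; simpl; auto.
  - rewrite IA, IB; reflexivity.
  - f_equal. rewrite IA. apply lsubst_ext. intros [x|]; reflexivity.
Qed.

Lemma lsubst_lren V (M : lterm V) : forall W U (r : V -> W) (s : W -> lterm U),
  lsubst s (lren r M) = lsubst (fun x => s (r x)) M.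
Proof.
  induction M as [V x|V c|V A IA B IB|V i A IA]; intros W U r s; simpl; auto.
  - rewrite IA, IB; reflexivity.
  - f_equal. rewrite IA. apply lsubst_ext. intros [x|]; reflexivity.
Qed.

Lemma lren_lren V W U (r : V -> W) (r' : W -> U) M :
  lren r' (lren r M) = lren (fun x => r' (r x)) M.
Proof.
  rewrite (lren_as_lsubst (lren r M)), lsubst_lren. symmetry.
  apply lren_as_lsubst.
Qed.

Lemma lren_lsubst V (M : lterm V) : forall W U (s : V -> lterm W) (r : W -> U),
  lren r (lsubst s M) = lsubst (fun x => lren r (s x)) M.
Proof.
  induction M as [V x|V c|V A IA B IB|V i A IA]; intros W U s r; simpl; auto.
  - rewrite IA, IB; reflexivity.
  - f_equal. rewrite IA. apply lsubst_ext. intros [x|]; simpl; auto.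
    rewrite !lren_lren. reflexivity.
Qed.

Lemma lsubst_var V (M : lterm V) : lsubst (@LVar V) M = M.
Proof.
  induction M as [V x|V c|V A IA B IB|V i A IA]; simpl; auto.
  - rewrite IA, IB; reflexivity.
  - f_equal. rewrite <- IA at 2. apply lsubst_ext. intros [x|]; reflexivity.
Qed.

Lemma lsubst_lsubst V (M : lterm V) :
  forall W U (s : V -> lterm W) (s' : W -> lterm U),
  lsubst s' (lsubst s M) = lsubst (fun x => lsubst s' (s x)) M.
Proof.
  induction M as [V x|V c|V A IA B IB|V i A IA]; intros W U s s'; simpl; auto.
  - rewrite IA, IB; reflexivity.
  - f_equal. rewrite IA. apply lsubst_ext. intros [x|]; simpl; auto.
    rewrite lsubst_lren, lren_lsubst. reflexivity.
Qed.

(* [root A B C]: the application [LApp A B] is a redex with contractum [C]. *)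
Inductive root {V : Type} : lterm V -> lterm V -> lterm V -> Prop :=
| root_beta M N : root (LLam i1 M) N (lsubst (inst N) M)
| root_K i N : root (LCst (cK i)) N (LLam i (lren Some N))
| root_S1 A B C :
    root (LApp (LApp (LCst cS1) A) B) C (LApp (LApp A C) (LApp B C))
| root_S3 A B C :
    root (LApp (LApp (LCst (cSup i1)) A) B) C (LApp (LApp A C) (LApp B C))
| root_lift i M N :
    root (LApp (LCst (cSup i)) (LLam i M)) (LLam i N) (LLam i (LApp M N)).

Inductive step {V : Type} : lterm V -> lterm V -> Prop :=
| step_root A B C : root A B C -> step (LApp A B) C
| step_I i : step (LCst (cI i)) (LLam i (LVar None))
| step_appl A A' B : step A A' -> step (LApp A B) (LApp A' B)
| step_appr A B B' : step B B' -> step (LApp A B) (LApp A B')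
| step_lam i M M' : step M M' -> step (LLam i M) (LLam i M').

Notation steps := (clos_refl_trans _ step).

Lemma clos_rt_map A B (RA : relation A) (RB : relation B) (f : A -> B) :
  (forall x y, RA x y -> clos_refl_trans _ RB (f x) (f y)) ->
  forall x y, clos_refl_trans _ RA x y -> clos_refl_trans _ RB (f x) (f y).
Proof.
  intros H x y S. induction S as [x y S|x|x y z _ IH1 _ IH2].
  - auto.
  - apply rt_refl.
  - exact (rt_trans _ _ _ _ _ IH1 IH2).
Qed.

Lemma steps_app V (A A' B B' : lterm V) :
  steps A A' -> steps B B' -> steps (LApp A B) (LApp A' B').
Proof.
  intros HA HB. apply rt_trans with (LApp A' B).
  - revert HA. apply (clos_rt_map (fun A => LApp A B)).
    intros; apply rt_step, step_appl; assumption.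
  - revert HB. apply clos_rt_map.
    intros; apply rt_step, step_appr; assumption.
Qed.

Lemma steps_lam V i (M M' : lterm (option V)) :
  steps M M' -> steps (LLam i M) (LLam i M').
Proof.
  apply clos_rt_map. intros; apply rt_step, step_lam; assumption.
Qed.

Lemma root_lsubst V W (s : V -> lterm W) A B C :
  root A B C -> root (lsubst s A) (lsubst s B) (lsubst s C).
Proof.
  intros [M N|i N|A' B' C'|A' B' C'|i M N]; simpl; try constructor.
  - replace (lsubst s (lsubst (inst N) M))
      with (lsubst (inst (lsubst s N)) (lsubst (lup s) M)); [constructor|].
    rewrite !lsubst_lsubst. apply lsubst_ext. intros [x|]; simpl; auto.
    rewrite lsubst_lren. apply lsubst_var.
  - replace (lsubst (lup s) (lren Some N)) with (lren Some (lsubst s N));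
      [constructor|].
    rewrite lsubst_lren, lren_lsubst. reflexivity.
Qed.

Lemma step_lsubst V (M N : lterm V) : step M N ->
  forall W (s : V -> lterm W), step (lsubst s M) (lsubst s N).
Proof.
  induction 1; intros W s; simpl; auto using @step, root_lsubst.
Qed.

Lemma steps_lsubst V W (s : V -> lterm W) M N :
  steps M N -> steps (lsubst s M) (lsubst s N).
Proof.
  apply clos_rt_map. intros; apply rt_step, step_lsubst; assumption.
Qed.

Lemma steps_lren V W (r : V -> W) M N :
  steps M N -> steps (lren r M) (lren r N).
Proof. rewrite !lren_as_lsubst. apply steps_lsubst. Qed.

Lemma steps_lsubst_arg V (M : lterm V) : forall W (s s' : V -> lterm W),
  (forall x, steps (s x) (s' x)) -> steps (lsubst s M) (lsubst s' M).
Proof.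
  induction M as [V x|V c|V A IA B IB|V i A IA]; intros W s s' E; simpl.
  - apply E.
  - apply rt_refl.
  - apply steps_app; auto.
  - apply steps_lam, IA. intros [x|]; simpl; [apply steps_lren, E|apply rt_refl].
Qed.

Lemma steps_inst V M (N N' : lterm V) :
  steps N N' -> steps (lsubst (inst N) M) (lsubst (inst N') M).
Proof.
  intros H. apply steps_lsubst_arg. intros [x|]; [apply rt_refl|exact H].
Qed.

(** * Superdevelopments and the Z property *)

Definition idx_eqb (i j : idx) : bool :=
  match i, j with i0, i0 | i1, i1 => true | _, _ => false end.

(** The left-hand sides of [root] do not overlap, so contraction at the root is a function. Making
    it total lets [star] apply it to parts that are already developed. *)
Definition app_dev {V : Type} (A B : lterm V) : lterm V :=
  match A, B with
  | LLam i1 M, _ => lsubst (inst B) M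
  | LCst (cK i), _ => LLam i (lren Some B)
  | LApp (LApp (LCst cS1) X) Y, _ => LApp (LApp X B) (LApp Y B)
  | LApp (LApp (LCst (cSup i1)) X) Y, _ => LApp (LApp X B) (LApp Y B)
  | LApp (LCst (cSup i)) (LLam j M), LLam k N =>
      if (idx_eqb i j && idx_eqb i k)%bool then LLam i (LApp M N) else LApp A B
  | _, _ => LApp A B
  end.

Lemma app_dev_root V (A B C : lterm V) : root A B C -> app_dev A B = C.
Proof. intros []; try reflexivity. destruct i; reflexivity. Qed.

(** Together with [app_dev_root] this characterises [app_dev], so later proofs argue by cases on
    [root] and avoid the nested match. *)
Lemma app_dev_cases V (A B : lterm V) :
  root A B (app_dev A B) \/ app_dev A B = LApp A B.
Proof.
  destruct A as [x|[| |i|i|i]|A1 A2|[|] M]; simpl; auto using @root.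
  destruct A1 as [x|[| |[|]|i|i]|A11 A12|j M]; auto.
  - destruct A2 as [|?|?|j M]; auto.
    destruct j, B as [|?|?|[|] N]; simpl; auto using @root.
  - destruct A2 as [|?|?|j M]; auto.
    destruct j, B as [|?|?|[|] N]; simpl; auto using @root.
  - destruct A11 as [x|[| |[|]|i|i]|A111 A112|j M]; auto using @root.
Qed.

Lemma steps_app_dev V (A B : lterm V) : steps (LApp A B) (app_dev A B).
Proof.
  destruct (app_dev_cases A B) as [H|H].
  - apply rt_step, step_root, H.
  - rewrite H. apply rt_refl.
Qed.

(** Substitution preserves redexes but may create one at the root; hence reduction here, not
    equality. *)
Lemma app_dev_lsubst V W (s : V -> lterm W) A B :
  steps (lsubst s (app_dev A B)) (app_dev (lsubst s A) (lsubst s B)).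
Proof.
  destruct (app_dev_cases A B) as [H|H].
  - rewrite (app_dev_root (root_lsubst s H)). apply rt_refl.
  - rewrite H. apply steps_app_dev.
Qed.

Ltac inv_steps :=
  repeat match goal with
    | H : step (LApp _ _) _ |- _ => inversion H; clear H; subst
    | H : step (LCst _) _ |- _ => inversion H; clear H; subst
    | H : step (LLam _ _) _ |- _ => inversion H; clear H; subst
    | H : root (LApp _ _) _ _ |- _ => inversion H; clear H; subst
    | H : root (LCst _) _ _ |- _ => inversion H; clear H; subst
    end.

Lemma app_dev_mono_l V (A A' B : lterm V) :
  step A A' -> steps (app_dev A B) (app_dev A' B).
Proof.
  intros S. destruct (app_dev_cases A B) as [H|H].
  - revert S. destruct H as [M N|i N|X Y Z|X Y Z|i M N]; intros S.
    + inv_steps. apply steps_lsubst, rt_step; assumption.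
    + inv_steps.
    + inv_steps; simpl; repeat apply steps_app; auto using rt_refl, rt_step.
    + inv_steps;
        try (simpl; repeat apply steps_app; auto using rt_refl, rt_step; fail).
      (* The critical pair of [S3]: the step in [A] lifts the binder out of [S3 (λM) (λN)]. Two beta
         steps take [(λM) B ((λN) B)] to the body [M N] instantiated with [B]. *)
      simpl. apply steps_app; apply rt_step, step_root, root_beta.
    + inv_steps.
      replace (app_dev _ _) with (LLam i (LApp M' N))
        by (destruct i; reflexivity).
      apply steps_lam, steps_app; auto using rt_refl, rt_step.
  - rewrite H. apply rt_trans with (LApp A' B).
    + apply rt_step, step_appl, S.
    + apply steps_app_dev.
Qed.

Lemma app_dev_mono_r V (A B B' : lterm V) :
  step B B' -> steps (app_dev A B) (app_dev A B').
Proof.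
  intros S. destruct (app_dev_cases A B) as [H|H].
  - revert S. destruct H as [M N|i N|X Y Z|X Y Z|i M N]; intros S.
    + apply steps_inst, rt_step, S.
    + apply steps_lam, steps_lren, rt_step, S.
    + simpl; repeat apply steps_app; auto using rt_refl, rt_step.
    + simpl; repeat apply steps_app; auto using rt_refl, rt_step.
    + inv_steps.
      replace (app_dev _ _) with (LLam i (LApp M M'))
        by (destruct i; reflexivity).
      apply steps_lam, steps_app; auto using rt_refl, rt_step.
  - rewrite H. apply rt_trans with (LApp A B').
    + apply rt_step, step_appr, S.
    + apply steps_app_dev.
Qed.

Lemma app_dev_mono V (A A' B B' : lterm V) :
  steps A A' -> steps B B' -> steps (app_dev A B) (app_dev A' B').
Proof.
  intros HA HB. apply rt_trans with (app_dev A' B).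
  - revert HA. apply (clos_rt_map (fun A => app_dev A B)).
    intros; apply app_dev_mono_l; assumption.
  - revert HB. apply clos_rt_map. intros; apply app_dev_mono_r; assumption.
Qed.

(** Full superdevelopment: the root is tested after the parts are developed, so redexes created by
    developing the parts are contracted as well. *)
Fixpoint star {V : Type} (M : lterm V) : lterm V :=
  match M with
  | LVar x => LVar x
  | LCst (cI i) => LLam i (LVar None)
  | LCst c => LCst c
  | LApp A B => app_dev (star A) (star B)
  | LLam i A => LLam i (star A)
  end.

Lemma steps_star V (M : lterm V) : steps M (star M).
Proof.
  induction M as [V x|V c|V A IA B IB|V i A IA]; simpl.
  - apply rt_refl.
  - destruct c; try apply rt_refl. apply rt_step, step_I.
  - exact (rt_trans _ _ _ _ _ (steps_app IA IB) (steps_app_dev _ _)).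
  - apply steps_lam, IA.
Qed.

Lemma star_lren V (M : lterm V) : forall W (r : V -> W),
  steps (lren r (star M)) (star (lren r M)).
Proof.
  induction M as [V x|V c|V A IA B IB|V i A IA]; intros W r; simpl.
  - apply rt_refl.
  - destruct c; apply rt_refl.
  - apply rt_trans with (app_dev (lren r (star A)) (lren r (star B))).
    + rewrite !lren_as_lsubst. apply app_dev_lsubst.
    + apply app_dev_mono; auto.
  - apply steps_lam, IA.
Qed.

(** Relating two substitutions pointwise by reduction is a condition that survives [lup], so the
    induction passes under binders. The beta case of [root_star] takes [inst N] for [s] and
    [inst (star N)] for [s']. *)
Lemma star_lsubst V (M : lterm V) : forall W (s s' : V -> lterm W),
  (forall x, steps (s' x) (star (s x))) ->
  steps (lsubst s' (star M)) (star (lsubst s M)).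
Proof.
  induction M as [V x|V c|V A IA B IB|V i A IA]; intros W s s' E; simpl.
  - apply E.
  - destruct c; apply rt_refl.
  - apply rt_trans with (app_dev (lsubst s' (star A)) (lsubst s' (star B))).
    + apply app_dev_lsubst.
    + apply app_dev_mono; auto.
  - apply steps_lam, IA. intros [x|]; simpl; [|apply rt_refl].
    exact (rt_trans _ _ _ _ _ (steps_lren _ (E x)) (star_lren _ _)).
Qed.

Lemma root_Sup_inv V i (A B C : lterm V) :
  root (LApp (LCst (cSup i)) A) B C ->
  exists M N, A = LLam i M /\ B = LLam i N.
Proof. inversion 1; subst. eauto. Qed.

Lemma root_star V (A B C : lterm V) : root A B C ->
  steps C (star (LApp A B)) /\ steps (star (LApp A B)) (star C).
Proof.
  intros [M N|i N|X Y Z|X Y Z|i M N].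
  - split; simpl.
    + apply rt_trans with (lsubst (inst (star N)) M).
      * apply steps_inst, steps_star.
      * apply steps_lsubst, steps_star.
    + apply star_lsubst. intros [x|]; apply rt_refl.
  - split; simpl; apply steps_lam.
    + apply steps_lren, steps_star.
    + apply star_lren.
  - split; simpl.
    + repeat apply steps_app; apply steps_star.
    + apply rt_trans with
        (LApp (app_dev (star X) (star Z)) (app_dev (star Y) (star Z)));
        [apply steps_app|]; apply steps_app_dev.
  (* The inner [app_dev] is kept folded: once [X] and [Y] are developed to binders, [S3 X Y] is
     itself a redex for the lift rule. The superdevelopment then lifts and applies beta, and the
     contractum catches up with one beta step on each side. *)
  - assert (E : star (LApp (LApp (LApp (LCst (cSup i1)) X) Y) Z) =
                app_dev (app_dev (LApp (LCst (cSup i1)) (star X)) (star Y))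
                        (star Z)) by reflexivity.
    rewrite E. simpl (star (LApp (LApp X Z) _)).
    destruct (app_dev_cases (LApp (LCst (cSup i1)) (star X)) (star Y))
      as [H|H].
    + destruct (root_Sup_inv H) as [M [N [EX EY]]]. rewrite EX, EY. simpl. split.
      * apply steps_app.
        -- apply rt_trans with (LApp (star X) (star Z)).
           ++ apply steps_app; apply steps_star.
           ++ rewrite EX. apply rt_step, step_root, root_beta.
        -- apply rt_trans with (LApp (star Y) (star Z)).
           ++ apply steps_app; apply steps_star.
           ++ rewrite EY. apply rt_step, step_root, root_beta.
      * apply steps_app_dev.
    + rewrite H. simpl. split.
      * repeat apply steps_app; apply steps_star.
      * apply rt_trans with
          (LApp (app_dev (star X) (star Z)) (app_dev (star Y) (star Z)));
          [apply steps_app|]; apply steps_app_dev.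
  - replace (star (LApp _ _)) with (LLam i (LApp (star M) (star N)))
      by (destruct i; reflexivity).
    split; simpl; apply steps_lam.
    + apply steps_app; apply steps_star.
    + apply steps_app_dev.
Qed.

(** The Z property of [star]. The first half bounds every one-step reduct of [M], the second makes
    [star] monotone for reduction. *)
Lemma step_star V (M N : lterm V) : step M N ->
  steps N (star M) /\ steps (star M) (star N).
Proof.
  induction 1 as [V A B C H|V i|V A A' B S [I1 I2]|V A B B' S [I1 I2]
                 |V i M M' S [I1 I2]].
  - apply root_star, H.
  - split; apply rt_refl.
  - split; simpl.
    + exact (rt_trans _ _ _ _ _ (steps_app I1 (steps_star _))
               (steps_app_dev _ _)).
    + apply app_dev_mono; auto using rt_refl.
  - split; simpl.
    + exact (rt_trans _ _ _ _ _ (steps_app (steps_star _) I1)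
               (steps_app_dev _ _)).
    + apply app_dev_mono; auto using rt_refl.
  - split; simpl; apply steps_lam; assumption.
Qed.

Notation conv := (clos_refl_sym_trans _ step).

(** Walking along the conversion, a forward step is simply prepended. A backward step costs one more
    [star]: the first half of Z reaches [star M'], and monotonicity carries the rest of the path
    through [star]. *)
Lemma conv_steps_star V (M N : lterm V) :
  conv M N -> exists n, steps M (Nat.iter n star N).
Proof.
  intros H. apply clos_rst_rst1n in H.
  induction H as [N|M M' N [S|S] _ [n IH]].
  - exists 0. apply rt_refl.
  - exists n. exact (rt_trans _ _ _ _ _ (rt_step _ _ _ _ S) IH).
  - exists (Datatypes.S n). apply rt_trans with (star M').
    + apply (step_star S).
    + simpl. revert IH. apply (clos_rt_map (@star V)).
      intros A B S'. apply (step_star S').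
Qed.

Lemma church_rosser V (M N : lterm V) :
  conv M N -> exists P, steps M P /\ steps N P.
Proof.
  intros H. destruct (conv_steps_star H) as [n Hn].
  exists (Nat.iter n star N). split; [exact Hn|].
  clear. induction n as [|n IH]; [apply rt_refl|].
  exact (rt_trans _ _ _ _ _ IH (steps_star _)).
Qed.

(** * From combinatory terms to the lambda calculus *)

Fixpoint emb {V : Type} (t : term V) : lterm V :=
  match t with
  | Var x => LVar x
  | S0 => LCst cS0
  | S1 => LCst cS1
  | S2 => LCst (cSup i0)
  | S3 => LCst (cSup i1)
  | K0 => LCst (cK i0)
  | K1 => LCst (cK i1)
  | I0 => LCst (cI i0)
  | I1 => LCst (cI i1)
  | u @ v => LApp (emb u) (emb v)
  end.

Lemma emb_Sup V i : emb (Sup i) = LCst (cSup i) :> lterm V.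
Proof. destruct i; reflexivity. Qed.

Lemma emb_K V i : emb (K i) = LCst (cK i) :> lterm V.
Proof. destruct i; reflexivity. Qed.

Lemma emb_I V i : emb (I i) = LCst (cI i) :> lterm V.
Proof. destruct i; reflexivity. Qed.

(** Turns the named variable [x] into the bound variable [None]. Equality on [V] is decided
    classically. *)
Definition bind_var {V : Type} (x y : V) : lterm (option V) :=
  LVar (if excluded_middle_informative (y = x) then None else Some y).

Lemma lsubst_bind_fresh V (x : V) t :
  ~ occurs x t -> lsubst (bind_var x) (emb t) = lren Some (emb t).
Proof.
  induction t as [y| | | | | | | | |u IHu v IHv]; simpl; auto.
  - intros H. unfold bind_var.
    destruct (excluded_middle_informative (y = x)); tauto.
  - intros H. rewrite IHu, IHv; tauto.
Qed.

(** Both ways of abstracting an [x]-free application, by [K] or by [Sup], end in the same binder;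
    the choice left open in [lam] thus disappears up to conversion. *)
Lemma lam_steps V i (x : V) u t : lam i x u t ->
  steps (emb t) (LLam i (lsubst (bind_var x) (emb u))).
Proof.
  assert (HK : forall u, ~ occurs x u ->
    steps (emb (K i @ u)) (LLam i (lsubst (bind_var x) (emb u)))).
  { intros w H. simpl. rewrite emb_K, (lsubst_bind_fresh _ _ H).
    apply rt_step, step_root, root_K. }
  induction 1 as [|t A E|u v H|u v u' v' _ IHu _ IHv].
  - simpl. unfold bind_var.
    destruct (excluded_middle_informative (x = x)); [|tauto].
    rewrite emb_I. apply rt_step, step_I.
  - apply HK. destruct t; simpl in *; auto. congruence.
  - apply HK, H.
  - simpl. rewrite emb_Sup.
    apply rt_trans with (LApp (LApp (LCst (cSup i))
      (LLam i (lsubst (bind_var x) (emb u))))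
      (LLam i (lsubst (bind_var x) (emb v)))).
    + repeat apply steps_app; auto using rt_refl.
    + apply rt_step, step_root, root_lift.
Qed.

Lemma clos_rst_map A B (RA : relation A) (RB : relation B) (f : A -> B) :
  (forall x y, RA x y -> RB (f x) (f y)) ->
  forall x y, clos_refl_sym_trans _ RA x y -> clos_refl_sym_trans _ RB (f x) (f y).
Proof.
  intros H x y S. induction S as [x y S|x|x y _ IH|x y z _ IH1 _ IH2].
  - apply rst_step; auto.
  - apply rst_refl.
  - apply rst_sym, IH.
  - exact (rst_trans _ _ _ _ _ IH1 IH2).
Qed.

Lemma joinable_conv V (M N P : lterm V) : steps M P -> steps N P -> conv M N.
Proof.
  intros HM HN. apply rst_trans with P.
  - apply clos_rt_clos_rst, HM.
  - apply rst_sym, clos_rt_clos_rst, HN.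
Qed.

(** Conversion is needed rather than reduction: in the cases [red_SK] and [red_lam] the right-hand
    side must be unfolded to its binder too. *)
Lemma red_conv V (t t' : term V) : red t t' -> conv (emb t) (emb t').
Proof.
  induction 1 as [u v w|u v w|u v|u|i u v|i x u v t t' _ IH Ht Ht'
                 |u u' v _ IH|u v v' _ IH].
  - apply rst_step, step_root, root_S1.
  - apply rst_step, step_root, root_S3.
  - apply clos_rt_clos_rst.
    apply rt_trans with (LApp (LLam i1 (lren Some (emb u))) (emb v)).
    + apply rt_step, step_appl, step_root, root_K.
    + rewrite <- (lsubst_var (emb u)) at 2.
      replace (lsubst (@LVar V) (emb u))
        with (lsubst (inst (emb v)) (lren Some (emb u)))
        by apply lsubst_lren.
      apply rt_step, step_root, root_beta.
  - apply clos_rt_clos_rst.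
    apply rt_trans with (LApp (LLam i1 (LVar None)) (emb u)).
    + apply rt_step, step_appl, step_I.
    + apply rt_step. exact (step_root (root_beta (LVar None) (emb u))).
  - simpl. rewrite !emb_K, emb_Sup.
    apply joinable_conv with (LLam i (lren Some (LApp (emb u) (emb v)))).
    + apply rt_trans with (LApp (LApp (LCst (cSup i))
        (LLam i (lren Some (emb u)))) (LLam i (lren Some (emb v)))).
      * repeat apply steps_app; auto using rt_refl; apply rt_step, step_root, root_K.
      * apply rt_step, step_root, root_lift.
    + apply rt_step, step_root, root_K.
  - apply rst_trans with (LLam i (lsubst (bind_var x) (emb u))).
    { apply clos_rt_clos_rst, lam_steps, Ht. }
    apply rst_trans with (LLam i (lsubst (bind_var x) (emb v))).
    2: { apply rst_sym, clos_rt_clos_rst, lam_steps, Ht'. }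
    revert IH.
    apply (clos_rst_map _ (fun M => LLam i (lsubst (bind_var x) M))).
    intros; apply step_lam, step_lsubst; assumption.
  - revert IH. apply (clos_rst_map _ (fun M => LApp M (emb v))).
    intros; apply step_appl; assumption.
  - revert IH. apply (clos_rst_map _ (fun M => LApp (emb u) M)).
    intros; apply step_appr; assumption.
Qed.

(** * Bracket abstraction *)

Fixpoint tsubst {V W : Type} (s : V -> term W) (t : term V) : term W :=
  match t with
  | Var x => s x
  | S0 => S0 | S1 => S1 | S2 => S2 | S3 => S3
  | K0 => K0 | K1 => K1 | I0 => I0 | I1 => I1
  | u @ v => tsubst s u @ tsubst s v
  end.

Definition tren {V W : Type} (r : V -> W) : term V -> term W :=
  tsubst (fun x => Var (r x)).

Definition tup {V W : Type} (s : V -> term W) (o : option V) :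
    term (option W) :=
  match o with None => Var None | Some x => tren Some (s x) end.

(** Partial inverse of the weakening [tren Some]. It fails exactly when the bound variable [None]
    occurs, so it serves as the occurrence test of [abs]. *)
Fixpoint lower {V : Type} (t : term (option V)) : option (term V) :=
  match t with
  | Var o => option_map (@Var V) o
  | S0 => Some S0 | S1 => Some S1 | S2 => Some S2 | S3 => Some S3
  | K0 => Some K0 | K1 => Some K1 | I0 => Some I0 | I1 => Some I1
  | u @ v =>
      match lower u, lower v with
      | Some u', Some v' => Some (u' @ v')
      | _, _ => None
      end
  end.

(** The final default is reached only for [Var None], since every other atom can be lowered. *)
Fixpoint abs {V : Type} (i : idx) (t : term (option V)) : term V :=
  match lower t with
  | Some u => K i @ u
  | None =>
      match t with
      | u @ v => Sup i @ abs i u @ abs i v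
      | _ => I i
      end
  end.

Lemma tsubst_ext V W (s s' : V -> term W) t :
  (forall x, s x = s' x) -> tsubst s t = tsubst s' t.
Proof. intros E. induction t; simpl; congruence. Qed.

Lemma tsubst_tsubst V W U (s : V -> term W) (s' : W -> term U) t :
  tsubst s' (tsubst s t) = tsubst (fun x => tsubst s' (s x)) t.
Proof. induction t; simpl; congruence. Qed.

Lemma tsubst_var V (t : term V) : tsubst (@Var V) t = t.
Proof. induction t; simpl; congruence. Qed.

Lemma tsubst_Sup V W (s : V -> term W) i : tsubst s (Sup i) = Sup i.
Proof. destruct i; reflexivity. Qed.

Lemma tsubst_K V W (s : V -> term W) i : tsubst s (K i) = K i.
Proof. destruct i; reflexivity. Qed.

Lemma tsubst_I V W (s : V -> term W) i : tsubst s (I i) = I i.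
Proof. destruct i; reflexivity. Qed.

Lemma lower_tren V (t : term V) : lower (tren Some t) = Some t.
Proof.
  unfold tren. induction t as [y| | | | | | | | |u IHu v IHv]; simpl; auto.
  rewrite IHu, IHv; reflexivity.
Qed.

Lemma lower_Some V (t : term (option V)) u : lower t = Some u -> t = tren Some u.
Proof.
  revert u; induction t as [[y|]| | | | | | | | |t1 IH1 t2 IH2]; simpl;
    intros u H; try (injection H as <-; reflexivity); [discriminate|].
  destruct (lower t1) as [u1|]; [|discriminate].
  destruct (lower t2) as [u2|]; [|discriminate].
  injection H as <-. rewrite (IH1 _ eq_refl), (IH2 _ eq_refl). reflexivity.
Qed.

Lemma lower_tsubst V W (s : V -> term W) t :
  lower (tsubst (tup s) t) = option_map (tsubst s) (lower t).
Proof.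
  induction t as [[y|]| | | | | | | | |u IHu v IHv]; simpl; auto.
  - apply lower_tren.
  - rewrite IHu, IHv. destruct (lower u), (lower v); reflexivity.
Qed.

Lemma abs_lower V i (t : term (option V)) u :
  lower t = Some u -> abs i t = K i @ u.
Proof. intros H. destruct t; cbn [abs]; rewrite H; reflexivity. Qed.

(** By [lower_tsubst] the choice between [K] and [Sup] at each node is unaffected by [s]. Using [K]
    only on atoms would break this: substituting [u v] for [y] in [K y] gives [K (u v)], not
    [Sup (K u) (K v)]. *)
Lemma abs_tsubst V W i (s : V -> term W) t :
  abs i (tsubst (tup s) t) = tsubst s (abs i t).
Proof.
  assert (HK : forall t u, lower t = Some u ->
            abs i (tsubst (tup s) t) = tsubst s (abs i t)).
  { intros t' u H. rewrite (abs_lower i _ H). simpl. rewrite tsubst_K.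
    apply abs_lower. rewrite lower_tsubst, H. reflexivity. }
  induction t as [[y|]| | | | | | | | |u IHu v IHv];
    try (eapply HK; reflexivity).
  - simpl. rewrite tsubst_I. reflexivity.
  - destruct (lower (u @ v)) as [w|] eqn:E; [exact (HK _ _ E)|].
    simpl in E |- *. rewrite !lower_tsubst, IHu, IHv, <- (tsubst_Sup s).
    destruct (lower u), (lower v); try discriminate; reflexivity.
Qed.

Definition cst_term {V : Type} (c : const) : term V :=
  match c with cS0 => S0 | cS1 => S1 | cSup i => Sup i | cK i => K i | cI i => I i end.

Fixpoint back {V : Type} (M : lterm V) : term V :=
  match M with
  | LVar x => Var x
  | LCst c => cst_term c
  | LApp A B => back A @ back B
  | LLam i A => abs i (back A)
  end.

Lemma back_emb V (t : term V) : back (emb t) = t.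
Proof. induction t; simpl; congruence. Qed.

Lemma tsubst_cst V W (s : V -> term W) c : tsubst s (cst_term c) = cst_term c.
Proof. destruct c as [| |[]|[]|[]]; reflexivity. Qed.

Lemma back_lren V (M : lterm V) : forall W (r : V -> W),
  back (lren r M) = tren r (back M).
Proof.
  induction M as [V x|V c|V A IA B IB|V i A IA]; intros W r; simpl.
  - reflexivity.
  - symmetry; apply tsubst_cst.
  - rewrite IA, IB. reflexivity.
  - rewrite IA. unfold tren. rewrite <- abs_tsubst. f_equal.
    apply tsubst_ext. intros [x|]; reflexivity.
Qed.

Lemma back_lsubst V (M : lterm V) : forall W (s : V -> lterm W),
  back (lsubst s M) = tsubst (fun x => back (s x)) (back M).
Proof.
  induction M as [V x|V c|V A IA B IB|V i A IA]; intros W s; simpl.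
  - reflexivity.
  - symmetry; apply tsubst_cst.
  - rewrite IA, IB. reflexivity.
  - rewrite IA, <- abs_tsubst. f_equal.
    apply tsubst_ext. intros [x|]; simpl; [apply back_lren|reflexivity].
Qed.

Notation reds1 := (clos_trans _ red).

Lemma reds1_appl V (u u' v : term V) : reds1 u u' -> reds1 (u @ v) (u' @ v).
Proof.
  induction 1; [apply t_step, red_appl|eapply t_trans]; eassumption.
Qed.

Lemma reds1_appr V (u v v' : term V) : reds1 v v' -> reds1 (u @ v) (u @ v').
Proof.
  induction 1; [apply t_step, red_appr|eapply t_trans]; eassumption.
Qed.

Lemma reds1_app V (u u' v v' : term V) :
  reds1 u u' -> reds1 v v' -> reds1 (u @ v) (u' @ v').
Proof.
  intros Hu Hv.
  exact (t_trans _ _ _ _ _ (reds1_appl v Hu) (reds1_appr u' Hv)).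
Qed.

Definition scons {V W : Type} (n : term W) (s : V -> term W) (o : option V) :
    term W :=
  match o with None => n | Some x => s x end.

Lemma tsubst_scons_tren V W (n : term W) (s : V -> term W) t :
  tsubst (scons n s) (tren Some t) = tsubst s t.
Proof. unfold tren. rewrite tsubst_tsubst. reflexivity. Qed.

(** The argument is consumed by [K1] or [I1], or distributed by [S3], always with at least one step.
    The constants of index 0 have no such rules, in accordance with [root_beta] being limited to
    [i1]. *)
Lemma abs_beta V W (s : V -> term W) (n : term W) t :
  reds1 (tsubst s (abs i1 t) @ n) (tsubst (scons n s) t).
Proof.
  assert (HK : forall t u, lower t = Some u ->
            reds1 (tsubst s (abs i1 t) @ n) (tsubst (scons n s) t)).
  { intros t' u H. rewrite (abs_lower i1 _ H), (lower_Some _ H).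
    rewrite tsubst_scons_tren. apply t_step, red_K1. }
  induction t as [[y|]| | | | | | | | |u IHu v IHv];
    try (eapply HK; reflexivity).
  - apply t_step, red_I1.
  - destruct (lower (u @ v)) as [w|] eqn:E; [exact (HK _ _ E)|].
    replace (abs i1 (u @ v)) with (S3 @ abs i1 u @ abs i1 v)
      by (simpl in E |- *; rewrite E; reflexivity).
    simpl. eapply t_trans; [apply t_step, red_S3|].
    apply reds1_app; assumption.
Qed.

(** * Simulating the lambda calculus by combinatory terms *)

Lemma lam_exists V i (x : V) u : exists t, lam i x u t.
Proof.
  assert (HA : forall t, is_atom t -> exists t', lam i x t t').
  { intros t H. destruct (classic (t = Var x)) as [->|E].
    - eexists; apply lam_var.
    - eexists; apply lam_atom; assumption. }
  induction u as [y| | | | | | | | |u [u' Hu] v [v' Hv]];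
    try (apply HA; exact Logic.I).
  eexists; apply lam_S; eassumption.
Qed.

(** Each intermediate term is given an arbitrary member of its abstraction; since the chain has a
    step, the members at the two ends may be prescribed independently. *)
Lemma lam_reds1 V i (x : V) u v : reds1 u v ->
  forall t t', lam i x u t -> lam i x v t' -> reds1 t t'.
Proof.
  induction 1 as [u v H|u v w _ IH1 _ IH2]; intros t t' Ht Ht'.
  - apply t_step. exact (red_lam H Ht Ht').
  - destruct (lam_exists i x v) as [t'' H''].
    apply t_trans with t''; auto.
Qed.

Lemma occurs_tren V W (r : V -> W) x t :
  occurs x (tren r t) -> exists y, occurs y t /\ r y = x.
Proof.
  unfold tren. induction t as [y| | | | | | | | |u IHu v IHv]; simpl; try tauto.
  - intros <-. exists y; auto.
  - intros [H|H]; [destruct (IHu H) as [y []]|destruct (IHv H) as [y []]];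
      exists y; auto.
Qed.

Definition ren_cons {V W : Type} (x : W) (r : V -> W) (o : option V) : W :=
  match o with None => x | Some y => r y end.

(** Passage from the nameless [abs] to the named [lam], with the bound variable opened as [x].
    Freshness of [x] gives the side condition of [lam_K]. *)
Lemma lam_abs V W i (x : W) (r : V -> W) t :
  (forall y, occurs (Some y) t -> r y <> x) ->
  lam i x (tren (ren_cons x r) t) (tren r (abs i t)).
Proof.
  assert (HK : forall t u, lower t = Some u ->
    (forall y, occurs (Some y) t -> r y <> x) ->
    lam i x (tren (ren_cons x r) t) (tren r (abs i t))).
  { intros t' u H F. rewrite (abs_lower i _ H). rewrite (lower_Some _ H) in *.
    replace (tren (ren_cons x r) (tren Some u)) with (tren r u)
      by (unfold tren; rewrite tsubst_tsubst; reflexivity).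
    replace (tren r (K i @ u)) with (K i @ tren r u)
      by (destruct i; reflexivity).
    assert (N : ~ occurs x (tren r u)).
    { intros O. destruct (occurs_tren _ _ _ O) as [y [Oy E]].
      refine (F y _ E). clear - Oy.
      unfold tren. induction u; simpl in *; intuition congruence. }
    destruct (tren r u) eqn:E;
      first [apply lam_K; assumption | apply lam_atom; [exact Logic.I|]].
    all: intros E'; rewrite E' in N; apply N; reflexivity. }
  induction t as [[y|]| | | | | | | | |u IHu v IHv]; intros F;
    try (eapply HK; [reflexivity|exact F]).
  - replace (tren r (abs i (Var None))) with (I (V := W) i)
      by (destruct i; reflexivity).
    apply lam_var.
  - destruct (lower (u @ v)) as [w|] eqn:E; [exact (HK _ _ E F)|].
    replace (tren r (abs i (u @ v)))
      with (Sup i @ tren r (abs i u) @ tren r (abs i v))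
      by (simpl in E |- *; rewrite E; destruct i; reflexivity).
    apply lam_S; [apply IHu|apply IHv]; intros y O; apply F; simpl; auto.
Qed.

Lemma image_of_occurs V W (r : V -> W) (t : term (option V)) :
  exists l, forall y, occurs (Some y) t -> In (r y) l.
Proof.
  induction t as [[y|]| | | | | | | | |u [l1 H1] v [l2 H2]];
    try (exists nil; simpl; intros; congruence || tauto).
  - exists (cons (r y) nil). simpl. intros z E. left. congruence.
  - exists (l1 ++ l2). intros y [O|O]; apply in_or_app; auto.
Qed.

(** Two terms are treated at once because [red_lam] abstracts the same variable on both sides. *)
Lemma fresh_for V W (W_infinite : ~ Finite W) (r : V -> W)
    (t t' : term (option V)) :
  exists x, (forall y, occurs (Some y) t -> r y <> x) /\
            (forall y, occurs (Some y) t' -> r y <> x).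
Proof.
  destruct (image_of_occurs r t) as [l H].
  destruct (image_of_occurs r t') as [l' H'].
  destruct (not_all_ex_not _ (fun x => In x (l ++ l'))) as [x N].
  { intros F. apply W_infinite. exists (l ++ l'). exact F. }
  exists x. split; intros y O <-; apply N, in_or_app; auto.
Qed.

(* Equality and strict reduction are kept apart because [λ_i x.u] has several
   members: a chain of no step does not lift to members of [λ_i x.u]. *)
Definition simulated (W : Type) {V : Type} (t t' : term V) : Prop :=
  t = t' \/ forall r : V -> W, reds1 (tren r t) (tren r t').

(** Unfolding [K] is invisible after [back], because [abs] prefers [K]. So is lifting, unless the
    bound variable is absent from both bodies, when it becomes a [red_SK] step. *)
Lemma root_back W V (A B C : lterm V) :
  root A B C -> simulated W (back (LApp A B)) (back C).
Proof.
  intros [M N|i N|X Y Z|X Y Z|i M N]; simpl.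
  - right. intros r. rewrite back_lsubst. unfold tren at 2.
    rewrite tsubst_tsubst.
    rewrite (tsubst_ext _ (scons (tren r (back N)) (fun x => Var (r x))))
      by (intros [x|]; reflexivity).
    apply abs_beta.
  - left. rewrite back_lren. symmetry. apply abs_lower, lower_tren.
  - right. intros r. apply t_step, red_S1.
  - right. intros r. apply t_step, red_S3.
  - destruct (lower (back M)) as [u|] eqn:Eu.
    + destruct (lower (back N)) as [v|] eqn:Ev; [|left; reflexivity].
      right. intros r.
      rewrite (abs_lower i _ Eu), (abs_lower i _ Ev).
      unfold tren; simpl. rewrite ?tsubst_K, tsubst_Sup. apply t_step, red_SK.
    + left; reflexivity.
Qed.

(** Under a binder the variable type grows to [option V], while [red_lam] needs names from one
    infinite type [W]. Quantifying over all renamings into [W] lets the induction hypothesis be used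
    at [ren_cons x r] with [x] fresh. *)
Lemma step_back W (W_infinite : ~ Finite W) V (M N : lterm V) :
  step M N -> simulated W (back M) (back N).
Proof.
  induction 1 as [V A B C H|V i|V A A' B _ [E|H]|V A B B' _ [E|H]
                 |V i M M' _ [E|H]]; simpl.
  - apply root_back, H.
  - left; reflexivity.
  - left. rewrite E; reflexivity.
  - right. intros r. apply reds1_appl, H.
  - left. rewrite E; reflexivity.
  - right. intros r. apply reds1_appr, H.
  - left. rewrite E; reflexivity.
  - right. intros r.
    destruct (fresh_for W_infinite r (back M) (back M')) as [x [F F']].
    eapply lam_reds1; [apply (H (ren_cons x r))| |]; apply lam_abs; assumption.
Qed.

Lemma steps_back V (V_infinite : ~ Finite V) (M N : lterm V) :
  steps M N -> clos_refl_trans _ red (back M) (back N).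
Proof.
  apply clos_rt_map. clear M N. intros M N S.
  destruct (step_back V_infinite S) as [->|H]; [apply rt_refl|].
  (* At top level the names are the variables themselves, so the identity renaming is taken. *)
  specialize (H (fun x => x)). unfold tren in H. rewrite !tsubst_var in H.
  apply clos_t_clos_rt, H.
Qed.

Theorem theorem5 (V : Type) (V_infinite : ~ Finite V) (t t1 t2 : term V) :
  fair t ->
  clos_refl_trans (term V) red t t1 ->
  clos_refl_trans (term V) red t t2 ->
  exists t3 : term V,
    clos_refl_trans (term V) red t1 t3 /\ clos_refl_trans (term V) red t2 t3.
Proof.
  intros _ H1 H2.
  assert (C : forall u v : term V,
            clos_refl_trans _ red u v -> conv (emb u) (emb v)).
  { induction 1.
    - apply red_conv; assumption.
    - apply rst_refl.
    - eapply rst_trans; eassumption. }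
  destruct (church_rosser (rst_trans _ _ _ _ _
              (rst_sym _ _ _ _ (C _ _ H1)) (C _ _ H2))) as [P [P1 P2]].
  exists (back P).
  (* Since [back] undoes [emb], the reductions to [P] translate into reductions starting from [t1]
     and [t2] themselves. *)
  rewrite <- (back_emb t1), <- (back_emb t2).
  split; apply steps_back; assumption.
Qed.
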